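(* Let $d\ge2$, $k\ge1$, let $\underline{A}=(A_1,\dots,A_k)\in\mathrm{GL}_d(\mathbb{R})^k$ and let $\underline{p}=(p_1,\dots,p_k)$ be a probability vector. Let $0<\alpha<1$ and assume that $\kappa:=\kappa_\alpha(\underline{A},\underline{p})<1$. Let $(\mathcal{F},\underline{f})$ be a discretization of $(\underline{A},\underline{p})$, i.e. $\mathcal{F}\subset\mathbb{P}(\mathbb{R}^d)$ is a finite (non-empty) set and $\underline{f}=(f_1,\dots,f_k)$ is a list of maps $f_j\colon\mathcal{F}\to\mathcal{F}$, with $\alpha$-error $$\Delta_\alpha=\max_{\hat v\in\mathcal{F}}\sum_{j=1}^k p_j\, d(\Phi_{A_j}(\hat v),f_j(\hat v))^\alpha .$$ Assume that the stochastic matrix $P_{\mathcal{F}}$ of the discretization is mixing, and let $\nu_{\mathcal{F}}$ be its unique stationary probability vector, regarded as a probability measure on $\mathcal{F}$. Let $\nu_A$ be the (unique) stationary measure of $(\underline{A},\underline{p})$ on $\mathbb{P}(\mathbb{R}^d)$. Then for every $\alpha$-Hölder continuous function $\varphi\colon\mathbb{P}(\mathbb{R}^d)\to\mathbb{R}$, $$\left|\int_{\mathbb{P}(\mathbb{R}^d)}\varphi\,d\nu_A-\int_{\mathcal{F}}\varphi\,d\nu_{\mathcal{F}}\right|\le\frac{\Delta_\alpha}{1-\kappa}\,v_\alpha(\varphi).$$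
   Context: $\mathbb{P}(\mathbb{R}^d)$ is the projective space, with the metric $d(\hat x,\hat y)=\frac{\|x\wedge y\|}{\|x\|\,\|y\|}$ (the sine of the angle between the lines $\hat x,\hat y$ spanned by non-zero vectors $x,y$); its diameter is $1$. For $A\in\mathrm{GL}_d(\mathbb{R})$, $\Phi_A\colon\mathbb{P}(\mathbb{R}^d)\to\mathbb{P}(\mathbb{R}^d)$ is the projective action of $A$. For an $\alpha$-Hölder function $\varphi$ on $\mathbb{P}(\mathbb{R}^d)$, $v_\alpha(\varphi)=\sup_{\hat x\ne\hat y}\frac{|\varphi(\hat x)-\varphi(\hat y)|}{d(\hat x,\hat y)^\alpha}$. $$\kappa_\alpha(\underline{A},\underline{p})=\sup_{\hat x\neq\hat y}\sum_{j=1}^k p_j\left(\frac{d(\Phi_{A_j}(\hat x),\Phi_{A_j}(\hat y))}{d(\hat x,\hat y)}\right)^\alpha .$$ A Borel probability measure $\nu$ on $\mathbb{P}(\mathbb{R}^d)$ is stationary for $(\underline{A},\underline{p})$ if $\nu=\sum_{j=1}^k p_j\,(\Phi_{A_j})_*\nu$. The stochastic matrix of the discretization is $P_{\mathcal{F}}=(P_{\mathcal{F}}(\hat w,\hat v))_{\hat w,\hat v\in\mathcal{F}}$ with $P_{\mathcal{F}}(\hat w,\hat v)=\sum_{j\,:\,f_j(\hat v)=\hat w}p_j$; this is the probability of transition from $\hat v$ to $\hat w$ (so $\sum_{\hat w}P_{\mathcal F}(\hat w,\hat v)=1$ for every $\hat v$). A stationary probability vector is a probability vector $\nu_{\mathcal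 F}$ on $\mathcal{F}$ with $\sum_{\hat v}P_{\mathcal{F}}(\hat w,\hat v)\,\nu_{\mathcal{F}}(\hat v)=\nu_{\mathcal{F}}(\hat w)$ for all $\hat w$. A stochastic matrix is mixing when its Markov chain has a single final class (a communicating class that cannot be left), and this class is aperiodic; a mixing stochastic matrix has a unique stationary probability vector. *)

(* Defs.v *)
From HB Require Import structures.
From mathcomp Require Import all_boot all_order all_algebra finmap.
From mathcomp Require Import all_classical all_reals all_analysis.
From mathcomp Require Import ring lra.

Set Implicit Arguments.
Unset Strict Implicit.
Unset Printing Implicit Defensive.

Import Order.TTheory GRing.Theory Num.Theory.

Local Open Scope classical_set_scope.
Local Open Scope ring_scope.

Section Euclid.
Variables (R : realType) (d : nat).
Implicit Types x y z : 'cV[R]_d.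

Definition edot x y : R := \sum_i x i ord0 * y i ord0.

(* The norm `|x| of the library on matrices is the maximum norm. *)
Definition enorm x : R := Num.sqrt (\sum_i x i ord0 ^+ 2).

(* The Euclidean norm of x /\ y in the second exterior power, for which the
   vectors e_i /\ e_j with i < j form an orthonormal basis. *)
Definition wedge_norm x y : R :=
  Num.sqrt (\sum_(i < d) \sum_(j < d | (i < j)%N)
    (x i ord0 * y j ord0 - x j ord0 * y i ord0) ^+ 2).

Definition sin_angle x y : R := wedge_norm x y / (enorm x * enorm y).

Lemma edotC x y : edot x y = edot y x.
Proof. by apply: eq_bigr => i _; rewrite mulrC. Qed.

Lemma edotDl x y z : edot (x + y) z = edot x z + edot y z.
Proof. by rewrite -big_split; apply: eq_bigr => i _; rewrite mxE mulrDl. Qed.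

Lemma edotZl a x y : edot (a *: x) y = a * edot x y.
Proof. by rewrite /edot big_distrr /=; apply: eq_bigr => i _; rewrite mxE mulrA. Qed.

Lemma edotDr x y z : edot z (x + y) = edot z x + edot z y.
Proof. by rewrite edotC edotDl !(edotC z). Qed.

Lemma edotZr a x y : edot y (a *: x) = a * edot y x.
Proof. by rewrite edotC edotZl (edotC y). Qed.

Lemma edot_ge0 x : 0 <= edot x x.
Proof. by apply: sumr_ge0 => i _; rewrite -expr2 sqr_ge0. Qed.

Lemma enormE x : enorm x = Num.sqrt (edot x x).
Proof. by []. Qed.

Lemma enorm_ge0 x : 0 <= enorm x. Proof. exact: sqrtr_ge0. Qed.

Lemma enorm_sqr x : enorm x ^+ 2 = edot x x.
Proof. by rewrite enormE sqr_sqrtr ?edot_ge0. Qed.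

Lemma enorm_gt0 x : x != 0 -> 0 < enorm x.
Proof.
move=> x0; rewrite lt_def enorm_ge0 andbT; apply: contra x0 => /eqP n0.
have /eqP : edot x x = 0 by rewrite -enorm_sqr n0 expr0n.
rewrite psumr_eq0 => [/allP h|i _]; last by rewrite -expr2 sqr_ge0.
apply/eqP/colP => i; rewrite mxE.
by have /= := h i (mem_index_enum i); rewrite mulf_eq0 orbb => /eqP.
Qed.

Lemma enormZ a x : enorm (a *: x) = `|a| * enorm x.
Proof.
by rewrite !enormE edotZl edotZr mulrA -expr2 sqrtrM ?sqr_ge0// sqrtr_sqr.
Qed.

Lemma wedge_norm_sqr x y :
  wedge_norm x y ^+ 2 = edot x x * edot y y - edot x y ^+ 2.
Proof.
rewrite sqr_sqrtr; last first.
  by apply: sumr_ge0 => i _; apply: sumr_ge0 => j _; exact: sqr_ge0.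
pose a (i j : 'I_d) := (x i ord0 * y j ord0 - x j ord0 * y i ord0) ^+ 2.
rewrite -/(a _ _); set S := (LHS).
have aE : \sum_i \sum_j a i j = S + S.
  have -> : \sum_i \sum_j a i j = S + \sum_(i < d) \sum_(j < d | (j < i)%N) a i j.
    rewrite /S -big_split; apply: eq_bigr => i _ /=.
    rewrite (bigID (fun j : 'I_d => (i < j)%N)) /=; congr (_ + _).
    rewrite [LHS](bigID (fun j : 'I_d => (j < i)%N)) /=.
    rewrite [X in _ + X]big1 ?addr0; last first.
      move=> j; rewrite -!leqNgt => /andP[ji ij].
      have -> : i = j by apply/val_inj/eqP; rewrite eqn_leq ji ij.
      by rewrite /a subrr expr0n.
    by apply: eq_bigl => j; case: ltngtP.
  congr (_ + _); rewrite (exchange_big_dep predT)//=.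
  by apply: eq_bigr => i _; apply: eq_bigr => j _; rewrite /a -sqrrN opprB.
have bE : \sum_i \sum_j a i j =
    (edot x x * edot y y - edot x y ^+ 2) *+ 2.
  have aiE i : \sum_j a i j = x i ord0 * x i ord0 * edot y y
      + y i ord0 * y i ord0 * edot x x
      - x i ord0 * y i ord0 * (2 * edot x y).
    rewrite /edot !big_distrr /= -big_split -sumrB /=.
    by apply: eq_bigr => j _; rewrite /a; ring.
  under eq_bigr => i _ do rewrite aiE.
  rewrite sumrB big_split -!big_distrl /= -/(edot x x) -/(edot y y).
  by rewrite -/(edot x y); ring.
by move: aE; rewrite bE -mulr2n => /(congr1 ( *%R 2^-1)); lra.
Qed.

Lemma wedge_norm_ge0 x y : 0 <= wedge_norm x y.
Proof. exact: sqrtr_ge0. Qed.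

Lemma wedge_normE x y :
  wedge_norm x y = Num.sqrt (edot x x * edot y y - edot x y ^+ 2).
Proof. by rewrite -wedge_norm_sqr sqrtr_sqr ger0_norm ?wedge_norm_ge0. Qed.

Lemma CauchySchwarz x y : edot x y ^+ 2 <= edot x x * edot y y.
Proof. by rewrite -subr_ge0 -wedge_norm_sqr sqr_ge0. Qed.

Lemma wedge_normC x y : wedge_norm x y = wedge_norm y x.
Proof. by rewrite !wedge_normE (edotC y x) (mulrC (edot y y)). Qed.

Lemma wedge_normZl a x y : wedge_norm (a *: x) y = `|a| * wedge_norm x y.
Proof.
rewrite !wedge_normE !(edotZl, edotZr).
have -> : a * (a * edot x x) * edot y y - (a * edot x y) ^+ 2 =
  a ^+ 2 * (edot x x * edot y y - edot x y ^+ 2) by ring.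
by rewrite sqrtrM ?sqr_ge0// sqrtr_sqr.
Qed.

Lemma wedge_norm_eq0 x y :
  wedge_norm x y = 0 -> y != 0 -> exists a, x = a *: y.
Proof.
move=> w0 y0; pose a := edot x y / edot y y; exists a.
have yy : edot y y != 0.
  by rewrite -enorm_sqr expf_neq0// gt_eqF ?enorm_gt0.
apply/eqP; rewrite -subr_eq0; apply/negPn/negP => /enorm_gt0.
rewrite lt0r => /andP[/negP + _]; apply.
suff : enorm (x - a *: y) ^+ 2 == 0 by rewrite expf_eq0.
rewrite enorm_sqr -scaleNr.
rewrite !(edotDl, edotDr, edotZl, edotZr) (edotC y x).
move: (wedge_norm_sqr x y); rewrite w0 expr0n /= => /esym/eqP.
rewrite subr_eq0 => /eqP xy.
have ay : edot y y * a = edot x y by rewrite /a mulrC divfK.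
apply/eqP/(mulfI yy); rewrite mulr0.
set b := edot x y in xy ay *; transitivity
  (edot x x * edot y y - 2 * (edot y y * a) * b + (edot y y * a) ^+ 2).
  by ring.
by rewrite ay xy; ring.
Qed.

Lemma sin_angleC x y : sin_angle x y = sin_angle y x.
Proof. by rewrite /sin_angle wedge_normC [enorm x * _]mulrC. Qed.

Lemma sin_angleZl a x y : a != 0 -> sin_angle (a *: x) y = sin_angle x y.
Proof.
move=> a0; rewrite /sin_angle wedge_normZl enormZ -[X in _ / X]mulrA.
by rewrite -mulf_div divff ?mul1r// normr_eq0.
Qed.

Lemma sin_angleZr a x y : a != 0 -> sin_angle x (a *: y) = sin_angle x y.
Proof. by move=> a0; rewrite sin_angleC sin_angleZl// sin_angleC. Qed.

Lemma sin_anglexx x : sin_angle x x = 0.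
Proof. by rewrite /sin_angle wedge_normE -expr2 subrr sqrtr0 mul0r. Qed.

Lemma sin_angle_ge0 x y : 0 <= sin_angle x y.
Proof. by rewrite divr_ge0 ?wedge_norm_ge0// mulr_ge0 ?enorm_ge0. Qed.

Lemma sin_angle_unit x y : edot x x = 1 -> edot y y = 1 ->
  sin_angle x y = Num.sqrt (1 - edot x y ^+ 2).
Proof.
by move=> x1 y1; rewrite /sin_angle wedge_normE !enormE x1 y1 sqrtr1 !mulr1 divr1.
Qed.

Let sin_angle_triangle_unit x y z :
  edot x x = 1 -> edot y y = 1 -> edot z z = 1 ->
  sin_angle x z <= sin_angle x y + sin_angle y z.
Proof.
move=> x1 y1 z1; rewrite !sin_angle_unit//.
have cs u v : edot u u = 1 -> edot v v = 1 -> 0 <= 1 - edot u v ^+ 2.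
  by move=> u1 v1; rewrite subr_ge0; have := CauchySchwarz u v; rewrite u1 v1 mulr1.
have := cs _ _ x1 y1; have := cs _ _ y1 z1; have := cs _ _ x1 z1.
have := CauchySchwarz (x + (- edot x y) *: y) (z + (- edot y z) *: y).
rewrite !(edotDl, edotDr, edotZl, edotZr) x1 y1 z1 (edotC y x) (edotC z y).
set a := edot x y; set b := edot y z; set c := edot x z => G hc hb ha.
set s := Num.sqrt (1 - a ^+ 2); set t := Num.sqrt (1 - b ^+ 2).
have s0 : 0 <= s by exact: sqrtr_ge0.
have t0 : 0 <= t by exact: sqrtr_ge0.
have sE : s ^+ 2 = 1 - a ^+ 2 by rewrite sqr_sqrtr.
have tE : t ^+ 2 = 1 - b ^+ 2 by rewrite sqr_sqrtr.
have st0 : 0 <= s * t by rewrite mulr_ge0.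
have {}G : `|c - a * b| <= s * t.
  rewrite -(@ler_pXn2r _ 2)// ?nnegrE//= real_normK ?num_real// exprMn sE tE.
  by apply: le_trans (le_trans G _); rewrite le_eqVlt; apply/orP; left; apply/eqP; ring.
have c1 : `|c| <= 1.
  by rewrite -(@ler_pXn2r _ 2)// ?nnegrE// real_normK ?num_real// expr1n -subr_ge0.
have ab : `|a * b| <= `|c| + s * t.
  have -> : a * b = c - (c - a * b) by ring.
  by rewrite (le_trans (ler_normB _ _))// lerD2l.
rewrite -(@ler_pXn2r _ 2)// ?nnegrE ?sqrtr_ge0 ?addr_ge0// sqr_sqrtr//.
have {}ab : (a * b) ^+ 2 <= (`|c| + s * t) ^+ 2.
  by rewrite -real_normK ?num_real// ler_pXn2r// nnegrE ?addr_ge0.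
have cE : `|c| ^+ 2 = c ^+ 2 by rewrite real_normK ?num_real.
have cst : `|c| * (s * t) <= s * t by rewrite ler_piMl.
have stE : (s * t) ^+ 2 = 1 - a ^+ 2 - b ^+ 2 + (a * b) ^+ 2.
  by rewrite exprMn sE tE; ring.
have -> : (s + t) ^+ 2 = s ^+ 2 + t ^+ 2 + 2 * (s * t) by ring.
rewrite sE tE.
have abE : (`|c| + s * t) ^+ 2 = c ^+ 2 + 2 * (`|c| * (s * t)) + (s * t) ^+ 2.
  by rewrite -cE; ring.
move: ab; rewrite abE stE; lra.
Qed.

Lemma sin_angle_triangle x y z : x != 0 -> y != 0 -> z != 0 ->
  sin_angle x z <= sin_angle x y + sin_angle y z.
Proof.
have unit_rep (u : 'cV[R]_d) : u != 0 ->
    exists2 a, a != 0 & edot (a *: u) (a *: u) = 1.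
  move=> /enorm_gt0 u0; exists (enorm u)^-1; first by rewrite invr_neq0// gt_eqF.
  rewrite -enorm_sqr enormZ ger0_norm ?invr_ge0 ?(ltW u0)//.
  by rewrite mulVf ?expr1n// gt_eqF.
move=> /unit_rep[a a0 x1] /unit_rep[b b0 y1] /unit_rep[c c0 z1].
have := sin_angle_triangle_unit x1 y1 z1.
by rewrite !(sin_angleZl, sin_angleZr).
Qed.

End Euclid.

(* The projective space of R^d: the lines through the origin in R^d. *)
Definition projspace (R : realType) (d : nat) :=
  {L : {vspace 'cV[R]_d} | \dim L == 1%N}.

HB.instance Definition _ R d := Choice.on (projspace R d).

Section Projective.
Variables (R : realType) (d : nat).
Implicit Types L M N : projspace R d.

Lemma line_dim (x : 'cV[R]_d) : x != 0 -> \dim <[x]> == 1%N.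
Proof. by move=> x0; rewrite dim_vline x0. Qed.

Definition line (x : 'cV[R]_d) (x0 : x != 0) : projspace R d :=
  exist _ <[x]>%VS (line_dim x0).

(* A nonzero vector of L, chosen arbitrarily; see [pdist_line]. *)
Definition spanning L : 'cV[R]_d := vpick (val L).

Lemma spanning_neq0 L : spanning L != 0.
Proof. by rewrite vpick0 -dimv_eq0 (eqP (valP L)). Qed.

Lemma spanningE L : val L = <[spanning L]>%VS.
Proof.
apply/esym/eqP; rewrite eqEdim dim_vline spanning_neq0 (eqP (valP L)) andbT.
by rewrite -memvE memv_pick.
Qed.

Definition pdist L M : R := sin_angle (spanning L) (spanning M).

Lemma pdist_line x y (x0 : x != 0) (y0 : y != 0) :
  pdist (line x0) (line y0) = wedge_norm x y / (enorm x * enorm y).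
Proof.
have spanning_line z (z0 : z != 0) :
    exists2 a, a != 0 & spanning (line z0) = a *: z.
  have /vlineP[a aE] : spanning (line z0) \in <[z]>%VS by exact: memv_pick.
  exists a => //; apply: contraNneq (spanning_neq0 (line z0)) => a0.
  by rewrite aE a0 scale0r.
have [a a0 xE] := spanning_line x x0; have [b b0 yE] := spanning_line y y0.
by rewrite /pdist xE yE sin_angleZl// sin_angleZr.
Qed.

Let pdistxx L : pdist L L = 0.
Proof. exact: sin_anglexx. Qed.

Let pdist_positivity L M : pdist L M = 0 -> L = M.
Proof.
move=> /eqP; rewrite mulf_eq0 invr_eq0 mulf_eq0.
rewrite !(gt_eqF (enorm_gt0 (spanning_neq0 _))) !orbF => /eqP w0.
have [a aE] := wedge_norm_eq0 w0 (spanning_neq0 M).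
apply/val_inj/eqP; rewrite /= eqEdim (eqP (valP L)) (eqP (valP M)) leqnn andbT.
by rewrite spanningE -memvE aE memvZ// memv_pick.
Qed.

Let pdistC L M : pdist L M = pdist M L.
Proof. exact: sin_angleC. Qed.

Let pdist_triangle M L N : pdist L N <= pdist L M + pdist M N.
Proof. by apply: sin_angle_triangle; exact: spanning_neq0. Qed.

HB.instance Definition _ := isMetric.Build R (projspace R d)
  pdistxx pdist_positivity pdistC pdist_triangle.

Lemma mdist_pdist L M : mdist L M = pdist L M.
Proof. by []. Qed.

Definition GL := {A : 'M[R]_d | A \in unitmx}.

Lemma proj_act_dim (A : GL) L :
  \dim (linfun (mulmx (val A) : 'cV[R]_d -> 'cV[R]_d) @: val L)%VS == 1%N.
Proof.
rewrite limg_dim_eq ?(valP L)//.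
suff /eqP -> : lker (linfun (mulmx (val A) : 'cV[R]_d -> 'cV[R]_d)) == 0%VS.
  exact: capv0.
apply/lker0P => x y; rewrite !lfunE /= => /(congr1 (mulmx (invmx (val A)))).
by rewrite !mulKmx// (valP A).
Qed.

Definition proj_act (A : GL) L : projspace R d :=
  exist (fun M : {vspace 'cV[R]_d} => \dim M == 1%N) _ (proj_act_dim A L).

End Projective.

(* Measurable spaces of the library are pointed, hence the dimension n.+1. *)
Section Borel.
Variables (R : realType) (n : nat).

Lemma const1_neq0 : (const_mx 1 : 'cV[R]_n.+1) != 0.
Proof.
by apply/eqP => /colP /(_ ord0); rewrite !mxE => /eqP; rewrite oner_eq0.
Qed.

HB.instance Definition _ := isPointed.Build (projspace R n.+1) (line const1_neq0).

Definition borel_proj := g_sigma_algebraType (@open (projspace R n.+1)).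

HB.instance Definition _ := Measurable.on borel_proj.

End Borel.

Section Cocycle.
Variables (R : realType) (n k : nat).
Implicit Types (A : 'I_k -> GL R n.+1) (p : 'I_k -> R) (alpha : R).

Definition prob_vector (I : finType) (q : I -> R) : Prop :=
  (forall i, 0 <= q i) /\ \sum_i q i = 1.

Definition kappa alpha A p : \bar R :=
  ereal_sup [set (\sum_j p j *
      (mdist (proj_act (A j) xy.1) (proj_act (A j) xy.2) /
         mdist xy.1 xy.2) `^ alpha)%:E
    | xy in [set xy : projspace R n.+1 * projspace R n.+1 | xy.1 != xy.2]].

Definition stationary_measure A p (nu : probability (borel_proj R n) R) : Prop :=
  forall B : set (borel_proj R n), measurable B ->
    nu B = (\sum_j (p j)%:E *
      pushforward nu (proj_act (A j) : borel_proj R n -> borel_proj R n) B)%E.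

Definition holder alpha (phi : projspace R n.+1 -> R) : Prop :=
  exists C : R, forall x y, `|phi x - phi y| <= C * mdist x y `^ alpha.

Definition holder_const alpha (phi : projspace R n.+1 -> R) : \bar R :=
  ereal_sup [set (`|phi xy.1 - phi xy.2| / mdist xy.1 xy.2 `^ alpha)%:E
    | xy in [set xy : projspace R n.+1 * projspace R n.+1 | xy.1 != xy.2]].

(* The terms of the maximum are nonnegative as soon as p is. *)
Definition alpha_error alpha A p (F : {fset projspace R n.+1})
    (f : 'I_k -> F -> F) : R :=
  \big[Num.max/0]_(v : F)
    \sum_j p j * mdist (proj_act (A j) (val v)) (val (f j v)) `^ alpha.

Definition discr_matrix p (F : finType) (f : 'I_k -> F -> F) (w v : F) : R :=
  \sum_(j | f j v == w) p j.

End Cocycle.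

(* For a stochastic matrix Q, Q w v is the probability of moving from v to w. *)
Section MarkovChain.
Variables (R : realType) (T : finType) (Q : T -> T -> R).

Fixpoint nstep (m : nat) (w v : T) : R :=
  if m is m'.+1 then \sum_u Q w u * nstep m' u v else (w == v)%:R.

Definition leads_to : rel T := connect (fun v w => 0 < Q w v).

Definition communicating_class (C : {set T}) : Prop :=
  exists v, C = [set w | leads_to v w && leads_to w v]%SET.

Definition final_class (C : {set T}) : Prop :=
  communicating_class C /\
  forall v w, v \in C -> 0 < Q w v -> w \in C.

(* The gcd of the return times of every state of C is 1. *)
Definition aperiodic (C : {set T}) : Prop :=
  forall v, v \in C -> forall g : nat,
    (forall m, (0 < m)%N -> 0 < nstep m v v -> (g %| m)%N) -> g = 1%N.

Definition mixing : Prop := exists2 C, unique final_class C & aperiodic C.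

Definition stationary_vector (nu : T -> R) : Prop :=
  prob_vector nu /\ forall w, \sum_v Q w v * nu v = nu w.

End MarkovChain.

(* Main.v *)
(** Write [T phi x = \sum_j p j * phi (A j x)] for the transfer operator.  If
    [phi] is [alpha]-Hoelder with constant [c], then [T phi] is
    [alpha]-Hoelder with constant [kappa * c] and has the same integral
    against the stationary measure, while replacing [phi] by [T phi] changes
    the integral against [nuF] by at most [c * Delta], since [nuF] is
    invariant under the discretized operator.  Iterating, the error for [phi]
    is at most [c * (Delta / (1 - kappa) + kappa ^+ N)] for every [N]; the
    last term bounds the oscillation of [T^N phi], the diameter being at
    most 1. *)
Require Import Defs.
From HB Require Import structures.
From mathcomp Require Import all_boot all_order all_algebra finmap.
From mathcomp Require Import all_classical all_reals all_analysis.
From mathcomp Require Import measurable_realfun.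
From mathcomp Require Import ring lra.

Set Implicit Arguments.
Unset Strict Implicit.
Unset Printing Implicit Defensive.

Import Order.TTheory GRing.Theory Num.Theory.
Import numFieldTopology.Exports.

Local Open Scope classical_set_scope.
Local Open Scope ring_scope.

(** * Integration against a finite mixture of image measures *)

Lemma ge0_integral_mixture d (T : measurableType d) (R : realType) (k : nat)
    (mu : {measure set T -> \bar R}) (c : 'I_k -> R)
    (g : 'I_k -> T -> T) :
  (forall j, 0 <= c j) -> (forall j, measurable_fun setT (g j)) ->
  (forall B, measurable B ->
    mu B = (\sum_j (c j)%:E * pushforward mu (g j) B)%E) ->
  forall f : T -> \bar R, measurable_fun setT f -> (forall x, 0 <= f x)%E ->
  (\int[mu]_x f x = \sum_j (c j)%:E * \int[mu]_x f (g j x))%E.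
Proof.
move=> c0 mg muE f mf f0.
(* [msum] takes a sequence indexed by [nat]: [insub] recovers the index below [k], and the zero
   measure fills the positions from [k] on, outside the sum. *)
pose m_ (i : nat) : {measure set T -> \bar R} :=
  if insub i is Some j then mscale (NngNum (c0 j))
    (@measure_function_pushforward__canonical__measure_function_Measure
       _ _ _ _ R mu _ (mg j)) else mzero.
have mE (j : 'I_k) : m_ j = mscale (NngNum (c0 j))
    (@measure_function_pushforward__canonical__measure_function_Measure
       _ _ _ _ R mu _ (mg j)) :> {measure set T -> \bar R}.
  by rewrite /m_ valK.
rewrite (@eq_measure_integral _ _ _ setT (msum m_ k)); last first.
  move=> B mB _; rewrite muE//= /msum; apply: eq_bigr => j _.
  by rewrite mE.
rewrite ge0_integral_measure_sum//; apply: eq_bigr => j _.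
by rewrite mE ge0_integral_mscale//= ge0_integral_pushforward.
Qed.

Lemma probability_Rintegral_cst d (T : measurableType d) (R : realType)
  (P : probability T R) (r : R) : \int[P]_(x in [set: T]) r = r.
Proof.
rewrite Rintegral_cst// -[RHS]mulr1; congr (_ * _).
exact: (congr1 fine (probability_setT P)).
Qed.

Lemma powR_div (R : realType) (x y r : R) : 0 <= x -> 0 <= y ->
  (x / y) `^ r = x `^ r / y `^ r.
Proof.
move=> x0 y0; rewrite powRM ?invr_ge0//; congr (_ * _).
by rewrite -powR_inv1// -powRrM mulN1r powRN.
Qed.

(** * Hoelder estimates in a metric space *)

Section Holder.
Context {R : realType} {T : metricType R}.
Implicit Types (phi : T -> R) (c alpha : R).

Lemma near_holder_lt c alpha (x : T) (e : R) : 0 < alpha -> 0 <= c -> 0 < e ->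
  \forall y \near x, c * mdist x y `^ alpha < e.
Proof.
move=> alpha0 c0 e0; apply/metricType_numDomainType.nbhs_mdistP.
have c1 : 0 < c + 1 by lra.
have r0 : 0 < e / (c + 1) by rewrite divr_gt0.
(* This radius r solves (c + 1) r^alpha = e; taking c + 1 instead of c avoids a division by zero
   when c = 0. *)
exists ((e / (c + 1)) `^ alpha^-1); first exact: powR_gt0.
move=> y /= xy.
have : mdist x y `^ alpha < e / (c + 1).
  have -> : e / (c + 1) = ((e / (c + 1)) `^ alpha^-1) `^ alpha.
    by rewrite -powRrM mulVf ?powRr1 ?lt0r_neq0// ltW.
  by apply: gt0_ltr_powR => //; rewrite nnegrE ?mdist_ge0 ?powR_ge0.
rewrite ltr_pdivlMr// mulrC; apply: le_lt_trans.
by rewrite ler_wpM2r ?powR_ge0//; lra.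
Qed.

(** The constant is a parameter, so that its decay under the transfer operator can be tracked. *)
Definition holder_le alpha c phi :=
  forall x y, `|phi x - phi y| <= c * mdist x y `^ alpha.

Lemma holder_le_continuous alpha c phi : 0 < alpha -> 0 <= c ->
  holder_le alpha c phi -> continuous phi.
Proof.
move=> alpha0 c0 phic x; apply/cvgrPdist_lt => e e0; near=> y.
apply: le_lt_trans (phic _ _) _; near: y.
exact: near_holder_lt.
Unshelve. all: by end_near. Qed.

(** The power alpha stays on both sides, the form in which [kappa] controls a single map. If g x and
    g y were at distance at least e, then e^alpha <= c d(x,y)^alpha, which fails for y near x. *)
Lemma powR_mdist_continuous (U : metricType R) (g : T -> U) c alpha :
  0 < alpha -> 0 <= c ->
  (forall x y, mdist (g x) (g y) `^ alpha <= c * mdist x y `^ alpha) ->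
  continuous g.
Proof.
move=> alpha0 c0 gc x; apply/metricType_numDomainType.cvgrPdist_lt => e e0.
near=> y; rewrite ltNge; apply/negP => le_e.
have : e `^ alpha <= c * mdist x y `^ alpha.
  apply: le_trans (gc x y).
  by apply: ge0_ler_powR; rewrite ?nnegrE ?mdist_ge0// ltW.
apply/negP; rewrite -ltNge; near: y.
by apply: near_holder_lt => //; exact: powR_gt0.
Unshelve. all: by end_near. Qed.

End Holder.

(** * Diameter, Borel structure and Hoelder functions on projective space *)

Section ProjectiveSpace.
Context {R : realType}.

(** By Lagrange's identity the squared wedge norm is the product of the squared norms minus a
    square. *)
Lemma mdist_le1 d (x y : projspace R d) : mdist x y <= 1.
Proof.
have x0 := enorm_gt0 (spanning_neq0 x); have y0 := enorm_gt0 (spanning_neq0 y).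
rewrite mdist_pdist /pdist /sin_angle ler_pdivrMr ?mulr_gt0// mul1r.
rewrite -(@ler_pXn2r _ 2)// ?nnegrE ?wedge_norm_ge0 ?mulr_ge0 ?enorm_ge0//.
by rewrite wedge_norm_sqr exprMn !enorm_sqr gerBl sqr_ge0.
Qed.

Lemma powR_mdist_le1 d (x y : projspace R d) (alpha : R) :
  0 <= alpha -> mdist x y `^ alpha <= 1.
Proof.
move=> alpha0; have <- : 1 `^ alpha = 1 by rewrite powR1.
rewrite ge0_ler_powR// ?nnegrE ?mdist_ge0//.
exact: mdist_le1.
Qed.

(** Ensures that the suprema in [kappa] and [holder_const] are over nonempty sets; over the empty
    set they would be -oo. *)
Lemma projspace_distinct n : (1 < n.+1)%N ->
  exists xy : projspace R n.+1 * projspace R n.+1, xy.1 != xy.2.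
Proof.
case: n => // n _; have e0 : delta_mx ord0 ord0 != 0 :> 'cV[R]_n.+2.
  apply/eqP => /colP/(_ ord0); rewrite !mxE !eqxx => /eqP.
  by rewrite oner_eq0.
exists (line (const1_neq0 R n.+1), line e0); apply/eqP => /(congr1 val) /= le.
have /vlineP[c /colP cE] : delta_mx ord0 ord0 \in <[const_mx 1 : 'cV[R]_n.+2]>%VS.
  by rewrite le memv_line.
(* The first coordinate gives c = 1, the last one c = 0. *)
have := cE ord0; have := cE ord_max; rewrite !mxE !eqxx /= mulr1 => <-.
by move=> /eqP; rewrite oner_eq0.
Qed.

Context {n : nat}.
Local Notation X := (borel_proj R n).

Lemma continuous_borel_fun (phi : projspace R n.+1 -> R) :
  continuous phi -> measurable_fun setT (phi : X -> R).
Proof.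
move=> /continuousP cphi; apply: (measurability _ (RGenOpens.measurableE R)).
move=> _ [_ [a [b ->] <-]]; rewrite setTI; apply: sub_sigma_algebra.
exact/cphi/interval_open.
Qed.

Lemma continuous_borel_map (g : projspace R n.+1 -> projspace R n.+1) :
  continuous g -> measurable_fun setT (g : X -> X).
Proof.
move=> /continuousP cg.
apply: (@measurability _ _ X X setT g (@open (projspace R n.+1)) erefl).
move=> _ [B oB <-]; rewrite setTI; apply: sub_sigma_algebra; exact: cg.
Qed.

Lemma holder_le_bounded alpha c (phi : projspace R n.+1 -> R)
  (v x : projspace R n.+1) :
  0 <= alpha -> 0 <= c -> holder_le alpha c phi -> `|phi x - phi v| <= c.
Proof.
move=> alpha0 c0 /(_ x v) /le_trans; apply.
by rewrite ler_piMr// powR_mdist_le1.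
Qed.

Lemma holder_le_integrable (nu : probability X R) alpha c
  (phi : projspace R n.+1 -> R) :
  0 < alpha -> 0 <= c -> holder_le alpha c phi ->
  nu.-integrable setT (EFin \o (phi : X -> R)).
Proof.
move=> alpha0 c0 phic.
apply: measurable_bounded_integrable => //.
- by rewrite -ge0_fin_numE// fin_num_measure.
- exact: continuous_borel_fun (holder_le_continuous alpha0 c0 phic).
pose v : projspace R n.+1 := line (const1_neq0 R n).
exists (`|phi v| + c); split; first exact: num_real.
move=> M /ltW hM x _; apply: le_trans hM.
have := holder_le_bounded v x (ltW alpha0) c0 phic.
have := ler_normD (phi v) (phi x - phi v).
by rewrite addrC subrK; lra.
Qed.

(** Base case of the iteration: phi stays within c of phi v everywhere, and nu has mass 1. *)
Lemma holder_le_Rintegral_close (nu : probability X R) alpha c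
  (phi : projspace R n.+1 -> R) v :
  0 < alpha -> 0 <= c -> holder_le alpha c phi ->
  `| \int[nu]_(x in [set: X]) phi x - phi v | <= c.
Proof.
move=> alpha0 c0 phic.
have iphi := holder_le_integrable nu alpha0 c0 phic.
have icst r : nu.-integrable setT (EFin \o (fun=> r)).
  apply: (@holder_le_integrable nu alpha 0 (fun=> r)) => // x y.
  by rewrite subrr normr0 mul0r.
have cstE := probability_Rintegral_cst nu.
have b x : phi v - c <= phi x <= phi v + c.
  have := holder_le_bounded v x (ltW alpha0) c0 phic.
  by rewrite ler_norml => /andP[]; lra.
rewrite ler_norml; apply/andP; split.
  rewrite lerBrDr addrC -[leLHS]cstE; apply: le_Rintegral => //.
  by move=> x _; case/andP: (b x).
rewrite lerBlDr addrC -[leRHS]cstE; apply: le_Rintegral => //.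
by move=> x _; case/andP: (b x).
Qed.

End ProjectiveSpace.

(** * The error bound for continuous maps that contract on average *)

Section Discretization.
Context {R : realType} {n k : nat}.
Local Notation PX := (projspace R n.+1).
Local Notation X := (borel_proj R n).
Variables (p : 'I_k -> R) (g : 'I_k -> PX -> PX) (alpha q : R).
Hypothesis p_prob : prob_vector p.
Hypothesis alpha_gt0 : 0 < alpha.
Hypothesis q_bounds : 0 <= q < 1.
Hypothesis g_continuous : forall j, continuous (g j).
Hypothesis g_contracting : forall x y,
  \sum_j p j * mdist (g j x) (g j y) `^ alpha <= q * mdist x y `^ alpha.

Let T (phi : PX -> R) (x : PX) : R := \sum_j p j * phi (g j x).

Let p_ge0 j : 0 <= p j. Proof. by case: p_prob. Qed.

Let q_ge0 : 0 <= q. Proof. by case/andP: q_bounds. Qed.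

(** The triangle inequality leads to the weighted sum of the distances to the power alpha, where the
    contraction on average applies; a single [g j] may expand. *)
Lemma transfer_holder_le (c : R) (phi : PX -> R) : 0 <= c ->
  holder_le alpha c phi -> holder_le alpha (q * c) (T phi).
Proof.
move=> c0 phic x y; rewrite /T -sumrB.
apply: le_trans (ler_norm_sum _ _ _) _.
apply: (@le_trans _ _ (c * \sum_j p j * mdist (g j x) (g j y) `^ alpha)).
  rewrite mulr_sumr; apply: ler_sum => j _.
  by rewrite -mulrBr normrM ger0_norm// mulrCA ler_wpM2l.
by rewrite -mulrA mulrCA ler_wpM2l.
Qed.

Section Stationary.
Variable nu : probability X R.
Hypothesis nu_stationary : forall B : set X, measurable B ->
  nu B = (\sum_j (p j)%:E * pushforward nu (g j : X -> X) B)%E.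

(** Stationarity makes nu a mixture of its images under the [g j], so the mixture formula for
    nonnegative functions applies to a shift of phi. *)
Lemma Rintegral_transfer (c : R) (phi : PX -> R) : 0 <= c -> holder_le alpha c phi ->
  \int[nu]_(x in [set: X]) T phi x = \int[nu]_(x in [set: X]) phi x.
Proof.
move=> c0 phic; pose v : PX := line (const1_neq0 R n).
(* Shifting by [M] makes [phi] nonnegative. *)
pose M := c - phi v.
have phiM_ge0 x : 0 <= phi x + M.
  have := holder_le_bounded v x (ltW alpha_gt0) c0 phic.
  by rewrite /M ler_norml => /andP[]; lra.
have holderM c' (psi : PX -> R) : holder_le alpha c' psi ->
    holder_le alpha c' (fun x => psi x + M).
  by move=> h x y; rewrite opprD addrACA subrr addr0.
have qc0 : 0 <= q * c by rewrite mulr_ge0.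
have RintM (c' : R) (psi : PX -> R) : 0 <= c' -> holder_le alpha c' psi ->
    \int[nu]_(x in [set: X]) (psi x + M) = \int[nu]_(x in [set: X]) psi x + M.
  move=> c'0 h; rewrite RintegralD//.
  - by congr (_ + _); exact: probability_Rintegral_cst.
  - exact: holder_le_integrable h.
  - apply: (@holder_le_integrable _ _ nu alpha 0 (fun=> M)) => // x y.
    by rewrite subrr normr0 mul0r.
apply: (@addIr _ M); rewrite -(RintM _ _ qc0 (transfer_holder_le c0 phic)).
rewrite -(RintM _ _ c0 phic) /Rintegral; congr fine.
have mg j := continuous_borel_map (@g_continuous j).
have mphiM : measurable_fun setT ((fun x => phi x + M) : X -> R).
  apply: continuous_borel_fun.
  exact: (holder_le_continuous alpha_gt0 c0 (holderM _ _ phic)).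
rewrite [RHS](ge0_integral_mixture p_ge0 mg nu_stationary); last 2 first.
- exact/measurable_EFinP.
- by move=> x; rewrite lee_fin.
(* As the weights sum to 1, adding M commutes with T. *)
transitivity (\int[nu]_x (\sum_(j < k) (p j)%:E * (phi (g j x) + M)%:E))%E.
  apply: eq_integral => x _.
  under eq_bigr do rewrite -EFinM mulrDr.
  by rewrite sumEFin big_split/= -mulr_suml p_prob.2 mul1r.
rewrite ge0_integral_sum//; last 2 first.
- move=> j; apply: measurable_funeM; apply/measurable_EFinP.
  exact: (measurableT_comp mphiM (mg j)).
- by move=> j x _; rewrite mule_ge0// lee_fin.
apply: eq_bigr => j _; rewrite ge0_integralZl//.
- apply/measurable_EFinP; exact: (measurableT_comp mphiM (mg j)).
- by move=> x _; rewrite lee_fin.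
- by rewrite lee_fin.
Qed.

Variables (F : {fset PX}) (f : 'I_k -> F -> F) (nuF : F -> R) (Delta : R).
Hypothesis nuF_stationary : stationary_vector (discr_matrix p f) nuF.
Hypothesis Delta_error : forall v : F,
  \sum_j p j * mdist (g j (val v)) (val (f j v)) `^ alpha <= Delta.

Let nuF_ge0 v : 0 <= nuF v. Proof. by case: nuF_stationary => -[]. Qed.

Let sum_nuF : \sum_v nuF v = 1. Proof. by case: nuF_stationary => -[]. Qed.

(** Averaging over the [f j] is the adjoint of the action of [discr_matrix] on vectors, and that
    action fixes nuF. *)
Lemma discrete_transfer (h : F -> R) :
  \sum_v (\sum_j p j * h (f j v)) * nuF v = \sum_v h v * nuF v.
Proof.
rewrite [RHS](eq_bigr (fun w => \sum_v \sum_j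
    (if f j v == w then p j * h (f j v) * nuF v else 0))); last first.
  move=> w _; rewrite -(nuF_stationary.2 w) mulr_sumr; apply: eq_bigr => v _.
  rewrite /discr_matrix mulrA mulr_sumr mulr_suml big_mkcond/=.
  by apply: eq_bigr => j _; case: eqP => // ->; rewrite (mulrC (h w)).
rewrite exchange_big; apply: eq_bigr => v _ /=.
rewrite exchange_big mulr_suml; apply: eq_bigr => j _ /=.
(* For fixed v and j, the only target that contributes is w = f j v. *)
by rewrite -big_mkcond/= (big_pred1 (f j v))// => w; rewrite /= eq_sym.
Qed.

(** Invariance of nuF turns the second sum into an average of phi over the points f j v; the Hoelder
    bound then compares these with g j v. *)
Lemma transfer_error (c : R) (phi : PX -> R) : 0 <= c -> holder_le alpha c phi ->
  `|\sum_v T phi (val v) * nuF v - \sum_v phi (val v) * nuF v| <= c * Delta.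
Proof.
move=> c0 phic; rewrite -[X in _ - X](discrete_transfer (phi \o val)) -sumrB.
apply: le_trans (ler_norm_sum _ _ _) _.
rewrite -[leRHS]mulr1 -sum_nuF mulr_sumr; apply: ler_sum => v _.
rewrite -mulrBl normrM (ger0_norm (nuF_ge0 v)) ler_wpM2r// /T -sumrB.
apply: le_trans (ler_norm_sum _ _ _) _.
apply: le_trans (ler_wpM2l c0 (Delta_error v)).
rewrite mulr_sumr; apply: ler_sum => j _ /=.
by rewrite -mulrBr normrM ger0_norm// mulrCA ler_wpM2l.
Qed.

Lemma iterated_transfer_error N (c : R) (phi : PX -> R) : 0 <= c -> holder_le alpha c phi ->
  `| \int[nu]_(x in [set: X]) phi x - \sum_v phi (val v) * nuF v |
  <= c * (Delta / (1 - q) + q ^+ N).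
Proof.
have q1 : 0 < 1 - q by rewrite subr_gt0; case/andP: q_bounds.
(* The induction keeps c and phi general, since its step passes to T phi with constant q c. *)
elim: N c phi => [|N IH] c phi c0 phic; last first.
  have step := transfer_error c0 phic.
  have := IH _ _ (mulr_ge0 q_ge0 c0) (transfer_holder_le c0 phic).
  rewrite (Rintegral_transfer c0 phic) => close.
  apply: le_trans (ler_distD _ _ _) (le_trans (lerD close step) _).
  (* The two bounds add up exactly: q c (Delta / (1 - q) + q^N) + c Delta = c (Delta / (1 - q) +
     q^(N+1)). *)
  rewrite le_eqVlt; apply/orP; left; apply/eqP; rewrite exprS.
  by field; rewrite gt_eqF.
(* c Delta is nonnegative because it bounds an absolute value in [transfer_error]. *)
have cDelta_ge0 : 0 <= c * (Delta / (1 - q)).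
  rewrite mulrA divr_ge0 ?(ltW q1)//.
  exact: le_trans (normr_ge0 _) (transfer_error c0 phic).
rewrite expr0 mulrDr mulr1 -[leLHS]add0r lerD//.
(* The total mass 1 of nuF spreads the integral over the points of F, to be compared with phi there
   one by one. *)
rewrite -[X in X - _]mulr1 -sum_nuF mulr_sumr -sumrB.
apply: le_trans (ler_norm_sum _ _ _) _.
rewrite -[leRHS]mulr1 -sum_nuF mulr_sumr; apply: ler_sum => v _.
rewrite -mulrBl normrM (ger0_norm (nuF_ge0 v)) ler_wpM2r//.
exact: holder_le_Rintegral_close phic.
Qed.

Lemma discretization_error (c : R) (phi : PX -> R) :
  0 <= c -> holder_le alpha c phi ->
  `| \int[nu]_(x in [set: X]) phi x - \sum_v phi (val v) * nuF v |
  <= Delta / (1 - q) * c.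
Proof.
(* The slack e absorbs c q^N for N large. *)
move=> c0 phic; apply/ler_addgt0Pr => e e0.
have : (fun N => c * q ^+ N) @ \oo --> c * 0.
  apply: cvgMl_tmp; apply: cvg_expr.
  by rewrite ger0_norm//; case/andP: q_bounds.
rewrite mulr0 => /cvgrPdist_lt/(_ _ e0) [N _ /(_ N (leqnn N))].
rewrite sub0r normrN => /(le_lt_trans (ler_norm _)) /ltW hN.
apply: le_trans (iterated_transfer_error N c0 phic) _.
by rewrite mulrDr [c * _]mulrC lerD2l.
Qed.

End Stationary.
End Discretization.

(** * From the supremum [kappa] to contraction on average *)

Section Kappa.
Context {R : realType} {n k : nat}.
Variables (A : 'I_k -> GL R n.+1) (p : 'I_k -> R) (alpha : R).
Hypothesis p_prob : prob_vector p.
Hypothesis alpha_gt0 : 0 < alpha.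
Hypothesis n_gt0 : (1 < n.+1)%N.
Hypothesis kappa_lt1 : (kappa alpha A p < 1)%E.

Let term_ge0 (z : R) j : 0 <= p j * (z `^ alpha).
Proof. by rewrite mulr_ge0 ?powR_ge0//; case: p_prob. Qed.

Lemma kappa_ge0 : (0 <= kappa alpha A p)%E.
Proof.
have [xy xyN] := @projspace_distinct R _ n_gt0.
apply: le_trans (ereal_sup_ubound (ex_intro2 _ _ xy xyN erefl)).
by rewrite lee_fin sumr_ge0// => j _; exact: term_ge0.
Qed.

(** Nonnegativity excludes -oo and the bound by 1 excludes +oo, so [fine] returns the true value. *)
Lemma fine_kappa_bounds : 0 <= fine (kappa alpha A p) < 1.
Proof.
move: kappa_ge0 kappa_lt1; case: (kappa _ _ _) => //= r.
by rewrite lee_fin lte_fin => -> ->.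
Qed.

Lemma kappa_contracting x y :
  \sum_j p j * mdist (proj_act (A j) x) (proj_act (A j) y) `^ alpha <=
  fine (kappa alpha A p) * mdist x y `^ alpha.
Proof.
(* The supremum omits the diagonal; there the left side vanishes, because 0^alpha = 0 for alpha >
   0. *)
have [->|xy] := eqVneq x y.
  rewrite big1 ?mulr_ge0 ?powR_ge0//.
    by case/andP: fine_kappa_bounds.
  by move=> j _; rewrite mdistxx powR0 ?mulr0// gt_eqF.
have d_gt0 : 0 < mdist x y by rewrite mdist_gt0.
rewrite -ler_pdivrMr ?powR_gt0// mulr_suml.
have kfin : kappa alpha A p \is a fin_num.
  by rewrite ge0_fin_numE ?kappa_ge0// (lt_trans kappa_lt1) ?ltry.
rewrite -lee_fin fineK//.
apply: le_trans (ereal_sup_ubound (ex_intro2 _ _ (x, y) xy erefl)).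
rewrite lee_fin; apply: ler_sum => j _ /=.
by rewrite (@powR_div _ (mdist _ _) (mdist x y)) ?mdist_ge0// mulrA.
Qed.

(* A single term of the sum defining [kappa] is at most [kappa], so that the
   contraction hypothesis alone makes [proj_act (A j)] Lipschitz. *)
Lemma proj_act_continuous j : 0 < p j -> continuous (proj_act (A j)).
Proof.
move=> pj; have c0 : 0 <= fine (kappa alpha A p) / p j.
  by rewrite divr_ge0 ?(ltW pj)//; case/andP: fine_kappa_bounds.
apply: (powR_mdist_continuous alpha_gt0 c0) => x y.
rewrite mulrAC ler_pdivlMr// mulrC; apply: le_trans (kappa_contracting x y).
by rewrite (bigD1 j)//= lerDl sumr_ge0.
Qed.

End Kappa.

(** * The optimal Hoelder constant as a real number *)

Section HolderConstant.
Context {R : realType} {n : nat}.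
Variables (alpha : R) (phi : projspace R n.+1 -> R).
Hypothesis n_gt0 : (1 < n.+1)%N.
Hypothesis phi_holder : holder alpha phi.

Let quotient_le x y : x != y ->
  ((`|phi x - phi y| / mdist x y `^ alpha)%:E <= holder_const alpha phi)%E.
Proof.
by move=> xy; apply: (ereal_sup_ubound (ex_intro2 _ _ (x, y) xy erefl)).
Qed.

Lemma holder_const_ge0 : (0 <= holder_const alpha phi)%E.
Proof.
have [[x y] /= xy] := @projspace_distinct R _ n_gt0.
by apply: le_trans (quotient_le xy); rewrite lee_fin divr_ge0 ?powR_ge0.
Qed.

(** Any Hoelder constant C bounds all the quotients. Finiteness matters because [fine] sends
    infinite values to 0. *)
Lemma holder_const_fin_num : holder_const alpha phi \is a fin_num.
Proof.
rewrite ge0_fin_numE ?holder_const_ge0//.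
have [C phiC] := phi_holder; apply: (@le_lt_trans _ _ C%:E); last exact: ltry.
apply: ge_ereal_sup => _ [[x y] /= xy <-].
by rewrite lee_fin ler_pdivrMr// powR_gt0// mdist_gt0.
Qed.

Lemma holder_const_le : holder_le alpha (fine (holder_const alpha phi)) phi.
Proof.
move=> x y; have [->|xy] := eqVneq x y.
  by rewrite subrr normr0 mulr_ge0 ?powR_ge0// fine_ge0 ?holder_const_ge0.
rewrite -ler_pdivrMr ?powR_gt0 ?mdist_gt0// -lee_fin.
by rewrite fineK ?holder_const_fin_num// quotient_le.
Qed.

End HolderConstant.

Theorem theorem4 (R : realType) (n k : nat) (hd : (2 <= n.+1)%N)
  (hk : (1 <= k)%N)
  (A : 'I_k -> GL R n.+1) (p : 'I_k -> R) (hp : prob_vector p)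
  (alpha : R) (halpha : 0 < alpha < 1)
  (hkappa : (kappa alpha A p < 1)%E)
  (F : {fset projspace R n.+1}) (hF : F != fset0) (f : 'I_k -> F -> F)
  (hmix : mixing (discr_matrix p f))
  (nuF : F -> R) (hnuF : stationary_vector (discr_matrix p f) nuF)
  (nuA : probability (borel_proj R n) R) (hnuA : stationary_measure A p nuA)
  (phi : projspace R n.+1 -> R) (hphi : holder alpha phi) :
  `| \int[nuA]_(x in [set: borel_proj R n]) phi x
     - \sum_(v : F) phi (val v) * nuF v |
  <= alpha_error alpha A p f / (1 - fine (kappa alpha A p))
     * fine (holder_const alpha phi).
Proof.
have alpha0 : 0 < alpha by case/andP: halpha.
(* [proj_act (A j)] is only known to be continuous when [0 < p j], see
   [proj_act_continuous]; the other maps are immaterial. *)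
pose g j := if 0 < p j then proj_act (A j) else id.
(* [h] receives the map itself, so one replacement serves both the discretization error and the
   contraction. *)
have pg (h : 'I_k -> (projspace R n.+1 -> projspace R n.+1) -> R) :
    \sum_j p j * h j (proj_act (A j)) = \sum_j p j * h j (g j).
  apply: eq_bigr => j _; rewrite /g; case: ltP => // pj.
  suff -> : p j = 0 by rewrite !mul0r.
  by apply/eqP; rewrite eq_le pj; case: hp => ->.
have error_le (v : F) : \sum_j p j * mdist (g j (val v)) (val (f j v)) `^ alpha
    <= alpha_error alpha A p f.
  rewrite -(pg (fun j u => mdist (u (val v)) (val (f j v)) `^ alpha)).
  exact: le_bigmax.
have g_continuous j : continuous (g j).
  rewrite /g; case: ifPn => [pj|_ x]; last exact: cvg_id.
  exact: (proj_act_continuous hp alpha0 hd hkappa pj).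
have g_contracting x y : \sum_j p j * mdist (g j x) (g j y) `^ alpha <=
    fine (kappa alpha A p) * mdist x y `^ alpha.
  rewrite -(pg (fun _ u => mdist (u x) (u y) `^ alpha)).
  exact: kappa_contracting.
have g_stationary (B : set (borel_proj R n)) : measurable B ->
    nuA B = (\sum_j (p j)%:E * pushforward nuA (g j : borel_proj R n -> borel_proj R n) B)%E.
  move=> mB; rewrite hnuA//; apply: eq_bigr => j _; rewrite /g.
  case: ltP => // pj; suff -> : p j = 0 by rewrite !mul0e.
  by apply/eqP; rewrite eq_le pj; case: hp => ->.
apply: (discretization_error hp alpha0 _ g_continuous g_contracting g_stationary
  hnuF error_le).
- exact: fine_kappa_bounds.
- by rewrite fine_ge0 ?holder_const_ge0.
- exact: holder_const_le.
Qed.
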